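(* Let $N$ and $r$ be integers with $r\ge 0$ and $2^r \le N < 2^{r+1}$. Then $$\frac{3N}{2} - \frac{r^2+7r+6}{4} \;\le\; \sum_{n=0}^{N-1} t(n) \;<\; \frac{3N}{2} - \frac12 .$$
   Context: The Stern sequence $(s(n))_{n\ge0}$ is defined by $s(0)=0$, $s(1)=1$, $s(2n)=s(n)$, $s(2n+1)=s(n)+s(n+1)$. It is known that $s(n+1)\ge1$ for all $n\ge0$. Define $t(n)=\frac{s(n)}{s(n+1)}$ for $n\ge 0$. *)

(* Defs.v *)
From mathcomp Require Import all_boot all_order all_algebra.
From mathcomp Require Import zify.

Set Implicit Arguments.
Unset Strict Implicit.
Unset Printing Implicit Defensive.

Import GRing.Theory.

(* The recursion n |-> n./2, n./2.+1 is not structural, so it is run with fuel;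
   any fuel k >= n gives the same value (stern_fuelE). *)
Fixpoint stern_fuel (k n : nat) : nat :=
  if k is k'.+1 then
    if n <= 1 then n
    else if odd n then stern_fuel k' n./2 + stern_fuel k' n./2.+1
    else stern_fuel k' n./2
  else 0.

Definition stern (n : nat) : nat := stern_fuel n n.

Lemma stern_fuelE (k n : nat) : n <= k -> stern_fuel k n = stern n.
Proof.
suff H m : forall k l, m <= k -> m <= l -> stern_fuel k m = stern_fuel l m.
  by move=> le_nk; apply: H.
elim/ltn_ind: m => m IH [|k1] [|l1] /= km lm //; try by have -> : m = 0 by lia.
case: ifPn => // m_gt1; case: ifP => m_odd.
  by congr (_ + _); apply: IH; lia.
by apply: IH; lia.
Qed.

Lemma stern0 : stern 0 = 0. Proof. by []. Qed.

Lemma stern1 : stern 1 = 1. Proof. by []. Qed.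

Lemma stern_rec (n : nat) : 1 < n ->
  stern n = if odd n then stern n./2 + stern n./2.+1 else stern n./2.
Proof.
case: n => [|n] // n_gt1; rewrite {1}/stern /= ifF; last by lia.
by case: ifP => n_odd; rewrite !stern_fuelE //; lia.
Qed.

Lemma stern_double (n : nat) : stern (2 * n) = stern n.
Proof.
case: n => [|n] //; rewrite stern_rec; last by lia.
by rewrite ifF; [congr stern; lia | lia].
Qed.

Lemma stern_doubleS (n : nat) : stern (2 * n + 1) = stern n + stern n.+1.
Proof.
case: n => [|n] //; rewrite stern_rec; last by lia.
by rewrite ifT; [congr (stern _ + stern _); lia | lia].
Qed.

Lemma stern_gt0 (n : nat) : 0 < stern n.+1.
Proof.
elim/ltn_ind: n => n IH.
have [n_odd | n_even] := boolP (odd n).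
  have -> : n.+1 = 2 * (n./2).+1 by lia.
  by rewrite stern_double; apply: IH; lia.
have -> : n.+1 = 2 * n./2 + 1 by lia.
rewrite stern_doubleS addn_gt0; apply/orP.
case: n n_even IH => [|n] n_even IH; first by right.
by left; have -> : n.+1./2 = (n.+1./2).-1.+1 by [lia]; apply: IH; lia.
Qed.

Definition stern_ratio (n : nat) : rat :=
  ((stern n)%:R / (stern n.+1)%:R)%R.

(* Main.v *)
Require Import Defs.
From mathcomp Require Import all_boot all_order all_algebra.
From mathcomp Require Import zify ring lra.

(** Splitting each sum by the parity of the index uses t(2n) = t(n)/(1+t(n)) and
    t(2n+1) = 1+t(n), so summing g(t(n)) over n < 2M is summing (Lg)(t(n)) over
    n < M, where (Lg)(x) = g(x/(1+x)) + g(1+x). The operator L preserves the class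
    of increasing functions with g(1/x) = -g(x), and it preserves the value g(0).
    Hence halving repeatedly an M with 2^r <= M < 2^(r+1) shows that the sum of such
    a g over n < M lies between (r+1) g(0) and g(0). For h(x) = x/(1+x) - 1/2 this
    controls S(2M) - S(M) - 3M/2, where S(M) is the sum of t(n) over n < M, and
    induction on r concludes. *)

Set Implicit Arguments.
Unset Strict Implicit.
Unset Printing Implicit Defensive.

Import Order.TTheory GRing.Theory Num.Theory.
Local Open Scope ring_scope.

Lemma stern_ratio_ge0 (n : nat) : 0 <= stern_ratio n.
Proof. by rewrite divr_ge0 ?ler0n. Qed.

Lemma stern_ratio0 : stern_ratio 0 = 0.
Proof. by rewrite /stern_ratio stern0 mul0r. Qed.

Lemma stern_ratio_double (n : nat) :
  stern_ratio (2 * n) = stern_ratio n / (1 + stern_ratio n).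
Proof.
rewrite /stern_ratio -(addn1 (2 * n)) stern_double stern_doubleS natrD.
have := stern_gt0 n; rewrite -(ltr0n rat) => s1_gt0.
have := ler0n rat (stern n) => s_ge0.
by field; rewrite !lt0r_neq0 //; lra.
Qed.

Lemma stern_ratio_doubleS (n : nat) :
  stern_ratio (2 * n).+1 = 1 + stern_ratio n.
Proof.
rewrite /stern_ratio (_ : (2 * n).+2 = 2 * n.+1)%N; last by lia.
rewrite -(addn1 (2 * n)) stern_double stern_doubleS natrD.
have := stern_gt0 n; rewrite -(ltr0n rat) => s1_gt0.
by field; apply: lt0r_neq0.
Qed.

Lemma stern_ratio_double_lt1 (n : nat) : stern_ratio (2 * n) < 1.
Proof.
have t_ge0 := stern_ratio_ge0 n.
by rewrite stern_ratio_double ltr_pdivrMr; lra.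
Qed.

Lemma sum_double (V : zmodType) (F : nat -> V) (M : nat) :
  \sum_(0 <= n < 2 * M) F n = \sum_(0 <= n < M) (F (2 * n)%N + F (2 * n).+1).
Proof.
elim: M => [|M IH]; first by rewrite !big_nil.
rewrite (_ : 2 * M.+1 = (2 * M).+2)%N; last by lia.
by rewrite !big_nat_recr //= IH addrA.
Qed.

(** Oddness is asked at x > 0 only: since [0^-1] is 0, asking it at 0 would force g 0 = 0. *)
Definition nondecreasing_inv_odd (g : rat -> rat) : Prop :=
  (forall x y, 0 <= x -> x <= y -> g x <= g y) /\
  (forall x, 0 < x -> g x^-1 = - g x).

Definition split_op (g : rat -> rat) (x : rat) : rat := g (x / (1 + x)) + g (1 + x).

Lemma inv_odd1 (g : rat -> rat) : nondecreasing_inv_odd g -> g 1 = 0.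
Proof. by case=> _ /(_ 1 ltr01); rewrite invr1 => g1; lra. Qed.

Lemma mobius_le (x y : rat) : 0 <= x -> x <= y -> x / (1 + x) <= y / (1 + y).
Proof.
move=> x_ge0 le_xy.
rewrite ler_pdivrMr; last lra.
by rewrite mulrAC ler_pdivlMr; [nra | lra].
Qed.

(** Replacing x by 1/x swaps the two arguments up to inversion: x/(1+x) becomes 1/(1+x), and 1+x
    becomes (1+x)/x. *)
Lemma split_op_inv_odd (g : rat -> rat) :
  nondecreasing_inv_odd g -> nondecreasing_inv_odd (split_op g).
Proof.
case=> g_mono g_odd; split=> [x y x_ge0 le_xy | x x_gt0]; rewrite /split_op.
  by apply: lerD; apply: g_mono; rewrite ?mobius_le ?divr_ge0 //; lra.
have -> : x^-1 / (1 + x^-1) = (1 + x)^-1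
  by field; rewrite !lt0r_neq0 //; lra.
have -> : 1 + x^-1 = (x / (1 + x))^-1
  by field; rewrite !lt0r_neq0 //; lra.
rewrite !g_odd ?divr_gt0 //; lra.
Qed.

Lemma split_op0 (g : rat -> rat) : nondecreasing_inv_odd g -> split_op g 0 = g 0.
Proof. by move=> /inv_odd1 g1; rewrite /split_op mul0r addr0 g1 addr0. Qed.

Lemma sum_inv_odd_double (g : rat -> rat) (M : nat) :
  \sum_(0 <= n < 2 * M) g (stern_ratio n)
    = \sum_(0 <= n < M) split_op g (stern_ratio n).
Proof.
rewrite sum_double; apply: eq_bigr => n _.
by rewrite stern_ratio_double stern_ratio_doubleS.
Qed.

Lemma half_dyadic (N r : nat) : (2 ^ r.+1 <= N < 2 ^ r.+2)%N ->
  exists2 M, (2 ^ r <= M < 2 ^ r.+1)%N & N = (2 * M)%N \/ N = (2 * M).+1.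
Proof.
rewrite !expnS => hN; exists N./2; first by lia.
by have [?|?] := boolP (odd N); [right | left]; lia.
Qed.

(** The induction on r keeps g general, since halving M replaces g by [split_op g]. *)
Lemma sum_inv_odd_bounds (r : nat) (g : rat -> rat) (M : nat) :
  nondecreasing_inv_odd g -> (2 ^ r <= M < 2 ^ r.+1)%N ->
  r.+1%:R * g 0 <= \sum_(0 <= n < M) g (stern_ratio n) <= g 0.
Proof.
elim: r g M => [|r IH] g M g_odd.
  move=> hM; have -> : M = 1%N by move: hM; rewrite expn0 expn1; lia.
  by rewrite big_nat1 stern_ratio0 mul1r lexx.
case/half_dyadic=> m hm M_eq.
have := IH _ _ (split_op_inv_odd g_odd) hm.
rewrite split_op0 // -sum_inv_odd_double => /andP[lo hi].
have [g_mono _] := g_odd; have g1 := inv_odd1 g_odd.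
(* If M = 2m+1, the extra term g(t(2m)) lies between g 0 and g 1 = 0; this costs one more g 0 in the
   lower bound. *)
have t_ge0 := stern_ratio_ge0 (2 * m); have t_lt1 := stern_ratio_double_lt1 m.
have gt_lo := g_mono _ _ (lexx 0) t_ge0.
have gt_hi := g_mono _ _ t_ge0 (ltW t_lt1).
rewrite -natr1 mulrDl mul1r.
case: M_eq => ->; last rewrite big_nat_recr //=.
all: by apply/andP; split; lra.
Qed.

(** Subtracting 1/2, the value of x/(1+x) at x = 1, makes it odd under inversion. *)
Definition centered_mobius (x : rat) : rat := x / (1 + x) - 1 / 2.

Lemma centered_mobius_inv_odd : nondecreasing_inv_odd centered_mobius.
Proof.
split=> [x y x_ge0 le_xy | x x_gt0]; rewrite /centered_mobius.
  by rewrite lerB // mobius_le.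
by field; rewrite !lt0r_neq0 //; lra.
Qed.

(** With t = t(n), t(2n) + t(2n+1) = t/(1+t) + 1 + t, and t/(1+t) = 1/2 + [centered_mobius t]. *)
Lemma sum_stern_ratio_double (M : nat) :
  \sum_(0 <= n < 2 * M) stern_ratio n
    = \sum_(0 <= n < M) stern_ratio n + 3 * M%:R / 2
      + \sum_(0 <= n < M) centered_mobius (stern_ratio n).
Proof.
rewrite sum_double; elim: M => [|M IH]; first by rewrite !big_nil; lra.
rewrite !big_nat_recr //= IH stern_ratio_double stern_ratio_doubleS.
by rewrite /centered_mobius -natr1; lra.
Qed.

Theorem theorem3p3 (N r : nat) (hN : (2 ^ r <= N < 2 ^ r.+1)%N) :
  3 * N%:R / 2 - (r%:R ^+ 2 + 7 * r%:R + 6) / 4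
    <= \sum_(0 <= n < N) stern_ratio n
  /\ \sum_(0 <= n < N) stern_ratio n < 3 * N%:R / 2 - 1 / 2.
Proof.
elim: r N hN => [|r IH] N hN.
  have -> : N = 1%N by move: hN; rewrite expn0 expn1; lia.
  by rewrite big_nat1 stern_ratio0; split; lra.
have [M hM N_eq] := half_dyadic hN.
have [lo hi] := IH M hM.
have := sum_inv_odd_bounds centered_mobius_inv_odd hM.
(* Only the two outer bounds are unfolded: they become -(r+1)/2 and -1/2. *)
rewrite {1 4}/centered_mobius mul0r => /andP[h_lo h_hi].
have S2M := sum_stern_ratio_double M.
have t_ge0 := stern_ratio_ge0 (2 * M); have t_lt1 := stern_ratio_double_lt1 M.
move: h_lo; rewrite -natr1 => h_lo.
(* From r to r+1, r^2+7r+6 grows by 2r+8: 2(r+1) pays for [h_lo], and 6 for the 3/2 that an odd N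
   adds while t(2M) >= 0. *)
case: N_eq => ->; last rewrite big_nat_recr //= -(natr1 (2 * M)).
all: by rewrite S2M natrM -natr1; split; nra.
Qed.
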